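(* Let $a\le 0$ be an integer. Define $b_{\mathcal{M}}(n)$, $n\ge0$, by $b_{\mathcal{M}}(0)=1$, $b_{\mathcal{M}}(1)=-1$, $b_{\mathcal{M}}(2)=a$ and, for $n\ge3$, $b_{\mathcal{M}}(n)=-\frac{1}{2}\sum_{k=0}^{n-1}b_{\mathcal{M}}(k)\binom{n+1}{k+1}$. For integers $0\le j\le d$ set $$s_{\mathcal{M}}(j,d)=\sum_{k=j}^d\frac{1}{k+1}\binom{d-j}{d-k}b_{\mathcal{M}}(k).$$ Then for all $d\ge0$ and $0\le j\le d$, $s_{\mathcal{M}}(j,d)=(-1)^ds_{\mathcal{M}}(d-j,d)$. *)

(* Defs.v *)
From HB Require Import structures.
From mathcomp Require Import all_boot all_order all_algebra.

Set Implicit Arguments.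
Unset Strict Implicit.
Unset Printing Implicit Defensive.

Import Order.TTheory GRing.Theory Num.Theory.
Local Open Scope ring_scope.

(* The next value of the sequence, given the list s of all previous values.
   The recurrence refers to every earlier term, so the sequence is built
   through its list of initial values; bM0, bM1, bM2 and bM_rec below are the
   defining equations. *)
Definition bM_next (a : int) (s : seq rat) : rat :=
  match size s with
  | 0%N => 1
  | 1%N => -1
  | 2%N => a%:~R
  | n => - (1 / 2) * \sum_(0 <= k < n) s`_k * 'C(n.+1, k.+1)%:R
  end.

Fixpoint bM_prefix (a : int) (n : nat) : seq rat :=
  if n is m.+1 then rcons (bM_prefix a m) (bM_next a (bM_prefix a m)) else [::].

Definition bM (a : int) (n : nat) : rat := bM_next a (bM_prefix a n).

Lemma size_bM_prefix a n : size (bM_prefix a n) = n.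
Proof. by elim: n => //= n IHn; rewrite size_rcons IHn. Qed.

Lemma nth_bM_prefix a n k : (k < n)%N -> (bM_prefix a n)`_k = bM a k.
Proof.
elim: n => //= n IHn; rewrite ltnS leq_eqVlt nth_rcons size_bM_prefix.
by case/predU1P => [-> | lt_kn]; rewrite ?ltnn ?eqxx // lt_kn IHn.
Qed.

Lemma bM0 a : bM a 0 = 1. Proof. by []. Qed.

Lemma bM1 a : bM a 1 = -1. Proof. by []. Qed.

Lemma bM2 a : bM a 2 = a%:~R. Proof. by []. Qed.

Lemma bM_rec a n : (3 <= n)%N ->
  bM a n = - (1 / 2) * \sum_(0 <= k < n) bM a k * 'C(n.+1, k.+1)%:R.
Proof.
move=> n_ge3; rewrite {1}/bM /bM_next size_bM_prefix.
case: n n_ge3 => [|[|[|n]]] // _; congr (_ * _).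
by apply: eq_big_nat => k /andP[_ lt_kn]; rewrite nth_bM_prefix.
Qed.

Definition sM (a : int) (j d : nat) : rat :=
  \sum_(j <= k < d.+1) 1 / k.+1%:R * 'C(d - j, d - k)%:R * bM a k.

(* Main.v *)
(** Let [L] be the linear functional on polynomials with
    [L ('X^k) = bM a k / (k + 1)], so that [sM a j d = L ('X^j * ('X + 1)^(d - j))]
    and the theorem says that [L] is invariant under [x |-> -1 - x].
    The recurrence says that [g n := L (('X + 1)^n + 'X^n)] vanishes for every odd
    [n] (and for every [n >= 3]).  Hence [L] and its composition with the
    reflection [x |-> -1 - x] agree on all [('X + 1)^n + 'X^n]; these polynomials
    span everything as [2] is invertible, so the two functionals are equal. *)
Require Import Defs.
From HB Require Import structures.
From mathcomp Require Import all_boot all_order all_algebra.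
From mathcomp Require Import ring.

Import Order.TTheory GRing.Theory Num.Theory.
Local Open Scope ring_scope.

Definition umbral {R : comNzRingType} (c : nat -> R) (p : {poly R}) : R :=
  \sum_(i < size p) p`_i * c i.

Lemma umbral_widen {R : comNzRingType} (c : nat -> R) (p : {poly R}) n : (size p <= n)%N ->
  umbral c p = \sum_(i < n) p`_i * c i.
Proof.
move=> le_pn; rewrite /umbral (big_ord_widen n (fun i => p`_i * c i)) //.
rewrite big_mkcond; apply: eq_bigr => i _.
by case: ltnP => // le_pi; rewrite nth_default ?mul0r.
Qed.

Lemma umbral_is_linear {R : comNzRingType} (c : nat -> R) :
  linear_for *%R (umbral c).
Proof.
move=> k p q; pose n := maxn (size p) (size q).
rewrite !(umbral_widen c _ n) ?leq_maxl ?leq_maxr //; last first.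
  by rewrite (leq_trans (size_polyD _ _)) // geq_max leq_maxr
    (leq_trans (size_scale_leq _ _)) ?leq_maxl.
rewrite mulr_sumr -big_split; apply: eq_bigr => i _ /=.
by rewrite coefD coefZ mulrDl mulrA.
Qed.

HB.instance Definition _ (R : comNzRingType) (c : nat -> R) :=
  GRing.isLinear.Build R {poly R} R *%R (umbral c) (umbral_is_linear c).

Lemma umbralXn {R : comNzRingType} (c : nat -> R) n : umbral c 'X^n = c n.
Proof.
rewrite (umbral_widen c _ n.+1) ?size_polyXn // big_ord_recr /= big1 ?add0r.
  by rewrite coefXn eqxx mul1r.
by move=> i _; rewrite coefXn ltn_eqF ?mul0r.
Qed.

(** The sign on the left is a polynomial, not a scalar, so linearity does not apply directly;
    reducing the exponent to its parity leaves only additivity. *)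
Lemma umbral_signM {R : comNzRingType} (c : nat -> R) n p :
  umbral c ((- 1) ^+ n * p) = (- 1) ^+ n * umbral c p.
Proof. by rewrite -!(signr_odd _ n); case: odd; rewrite ?mul1r // !mulN1r linearN. Qed.

Lemma umbral_XnXD1 {R : comNzRingType} (c : nat -> R) j m :
  umbral c ('X^j * ('X + 1) ^+ m) = \sum_(i < m.+1) 'C(m, i)%:R * c (j + i)%N.
Proof.
rewrite addrC exprDn mulr_sumr linear_sum; apply: eq_bigr => i _.
by rewrite expr1n mul1r mulrnAr -exprD linearMn /= umbralXn mulr_natl.
Qed.

(** By strong induction only the top term of the sum survives, leaving [2 * D n = 0]. This replaces
    the spanning argument. *)
Lemma binomial_transform_opp_eq0 (R : numDomainType) (D : nat -> R) :
  (forall n, \sum_(i < n.+1) 'C(n, i)%:R * D i + D n = 0) -> forall n, D n = 0.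
Proof.
move=> DE; elim/ltn_ind => n IHn; have := DE n.
rewrite big_ord_recr /= binn mul1r big1 => [|i _]; last by rewrite IHn ?mulr0.
by rewrite add0r -mulr2n => /eqP; rewrite mulrn_eq0 => /eqP.
Qed.

Lemma umbral_reflection (R : numDomainType) (c : nat -> R) :
    (forall n, odd n -> umbral c (('X + 1) ^+ n) + c n = 0) ->
  forall p, umbral c (p \Po (- 1 - 'X)) = umbral c p.
Proof.
move=> c_odd; have eqXn n : umbral c ((- 1 - 'X) ^+ n) = c n.
  (* Take [D n] to be the defect [umbral c ((- 1 - 'X) ^+ n) - c n]. *)
  apply/eqP; rewrite -subr_eq0; apply/eqP; move: n.
  apply: binomial_transform_opp_eq0 => n.
  under eq_bigr do rewrite mulrBr.
  rewrite big_split /= sumrN.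
  have <- : umbral c (('X + 1) ^+ n) = \sum_(i < n.+1) 'C(n, i)%:R * c i.
    by rewrite -[('X + 1) ^+ n]mul1r -(expr0 'X) umbral_XnXD1.
  have <- : umbral c ((- 'X) ^+ n)
      = \sum_(i < n.+1) 'C(n, i)%:R * umbral c ((- 1 - 'X) ^+ i).
    rewrite [in LHS](_ : - 'X = 1 + (- 1 - 'X)); last by ring.
    rewrite exprDn linear_sum; apply: eq_bigr => i _.
    by rewrite expr1n mul1r linearMn /= mulr_natl.
  have -> : - 1 - 'X = - ('X + 1) :> {poly R} by ring.
  rewrite (exprNn 'X) (exprNn ('X + 1)) !umbral_signM umbralXn.
  (* With [U = umbral c (('X + 1) ^+ n)], the goal reads [((-1)^n - 1) * (U + c n) = 0]: trivial for
     even [n], the hypothesis for odd [n]. *)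
  have := c_odd n; rewrite -signr_odd.
  case: (odd n) => [/(_ isT)/eqP|_]; last by rewrite expr0; ring.
  by rewrite addr_eq0 expr1 => /eqP ->; ring.
move=> p; rewrite comp_polyE linear_sum; apply: eq_bigr => i _.
by rewrite linearZ /= eqXn.
Qed.

Definition cM (a : int) (k : nat) : rat := bM a k / k.+1%:R.

Lemma sM_umbral a j d : (j <= d)%N ->
  sM a j d = umbral (cM a) ('X^j * ('X + 1) ^+ (d - j)).
Proof.
move=> le_jd; rewrite umbral_XnXD1 /sM -{1}[j]add0n big_addn subSn // big_mkord.
(* Here [k = j + i], and the symmetry of binomials turns ['C(d - j, d - k)] into ['C(d - j, i)]. *)
apply: eq_bigr => i _; rewrite (addnC i) subnDA bin_sub -1?ltnS ?ltn_ord //.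
by rewrite mul1r -mulrA mulrCA [_^-1 * _]mulrC.
Qed.

Lemma umbral_cM_odd a n : odd n -> umbral (cM a) (('X + 1) ^+ n) + cM a n = 0.
Proof.
rewrite -[('X + 1) ^+ n]mul1r -(expr0 'X) umbral_XnXD1.
(* Oddness discards [n = 2], where [a] is arbitrary; [n = 1] uses the initial values. *)
case: n => [|[|[|n]]] // _.
  by rewrite !big_ord_recr big_ord0 /cM bM0 bM1 /= !binE.
set m := n.+3; rewrite big_ord_recr /= binn mul1r add0n.
under eq_bigr => k _.
  have -> : 'C(m, k)%:R * cM a (0 + k) = bM a k * 'C(m.+1, k.+1)%:R / m.+1%:R.
    rewrite /cM add0n; have /(congr1 (fun x => x%:R : rat)) := mul_bin_diag m.+1 k.
    rewrite !natrM /= => E; have nz i : i.+1%:R != 0 :> rat by rewrite pnatr_eq0.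
    rewrite mulrCA -mulrA; congr (_ * _); apply/eqP.
    by rewrite eqr_div ?nz // mulrC E mulrC.
  over.
rewrite -mulr_suml /cM bM_rec // big_mkord -!mulrDl.
(* Each of the two copies of [bM a m] is minus half the sum, so the numerator cancels. *)
by apply/eqP; rewrite mulf_eq0; apply/orP; left; apply/eqP; field.
Qed.

Theorem mainTheorem11 (a : int) (ha : a <= 0) (d j : nat) (hj : (j <= d)%N) :
  sM a j d = (-1) ^+ d * sM a (d - j) d.
Proof.
rewrite !sM_umbral ?leq_subr // subKn // -(umbral_reflection _ _ (umbral_cM_odd a)).
(* The reflection exchanges ['X] and ['X + 1] up to sign; the signs [(-1)^j] and [(-1)^(d - j)]
   combine to [(-1)^d]. *)
rewrite rmorphM !rmorphXn rmorphD rmorph1 /= comp_polyX.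
have -> : - 1 - 'X + 1 = - 'X :> {poly rat} by ring.
have -> : - 1 - 'X = - ('X + 1) :> {poly rat} by ring.
rewrite [(- ('X + 1)) ^+ j]exprNn [(- 'X) ^+ _]exprNn mulrACA -exprD subnKC //.
by rewrite umbral_signM ['X^_ * _]mulrC.
Qed.
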